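(* Let $\mu$ be a probability measure on $\mathbb{R}^n$ satisfying the logarithmic Sobolev inequality $$\operatorname{Ent}_\mu(f^2) \leq 2 C_{\mathrm{LSI}}(\mu)\int |\nabla f|^2\, d\mu, \qquad C_{\mathrm{LSI}}(\mu)\leq 1,$$ and let $u : \mathbb{R}^n \to \mathbb{R}$ satisfy $$\operatorname{Ent}_\mu(u^2) \geq 2(1-\epsilon) \int |\nabla u|^2\, d\mu$$ for some $\epsilon \geq 0$. For any smooth function $h$ we have $$\int \nabla h \cdot \nabla u\, d\mu - \frac{1}{2} \int h u \log(u^2/\alpha)\, d\mu \leq \sqrt{\epsilon} \left( \int |\nabla u|^2\, d\mu \right)^{1/2} \left( \int |\nabla h|^2\, d\mu - \frac{1}{2} \int h^2 \log(u^2/\alpha)\, d\mu \right)^{1/2},$$ where $\alpha := \int u^2\, d\mu$.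
   Context: Here $\operatorname{Ent}_\mu(f^2) = \int f^2 \log f^2\, d\mu - \left( \int f^2\, d\mu \right) \log \int f^2\, d\mu$, and $C_{\mathrm{LSI}}(\mu)$ denotes the sharpest possible constant for $\mu$ in the logarithmic Sobolev inequality. The quantity $\int |\nabla h|^2\, d\mu - \frac12 \int h^2 \log(u^2/\alpha)\, d\mu$ is nonnegative, as a consequence of the logarithmic Sobolev inequality for $\mu$. No convexity assumption is made on $\mu$. *)

(* Defs.v *)
From HB Require Import structures.
From mathcomp Require Import all_boot all_order all_algebra.
From mathcomp Require Import all_classical all_reals all_analysis.
Set Implicit Arguments.
Unset Strict Implicit.
Unset Printing Implicit Defensive.
Import Order.TTheory GRing.Theory Num.Theory.
Import numFieldNormedType.Exports.
Local Open Scope classical_set_scope.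
Local Open Scope ring_scope.

Section Defs.
Context (R : realType) (n : nat).

(* R^n with its Borel sigma-algebra. *)
Definition borel_rV := g_sigma_algebraType (@open 'rV[R]_n).

(* The norm of 'rV[R]_n in the library is the max norm; it is used here only for
   its topology, the Euclidean structure being given by dotv. *)
Definition dotv (v w : 'rV[R]_n) : R := \sum_(i < n) v 0 i * w 0 i.

Definition partial (i : 'I_n) (f : 'rV[R]_n -> R) (x : 'rV[R]_n) : R :=
  'D_(delta_mx 0 i) f x.

Definition grad (f : 'rV[R]_n -> R) (x : 'rV[R]_n) : 'rV[R]_n :=
  \row_(i < n) partial i f x.

Fixpoint Ck (k : nat) (f : 'rV[R]_n -> R) : Prop :=
  match k with
  | 0%N => continuous f
  | k'.+1 => (forall x, differentiable f x) /\
             (forall i, Ck k' (partial i f))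
  end.

Definition smooth (f : 'rV[R]_n -> R) : Prop := forall k, Ck k f.

Variable mu : probability borel_rV R.

(* Since ln 0 = 0 in the library, g * ln g is 0 where g = 0, as usual.  The
   function g * ln g is bounded below, so that for nonnegative integrable g the
   first integral is well-defined, with values in ]-oo, +oo]. *)
Definition Ent (g : 'rV[R]_n -> R) : \bar R :=
  (\int[mu]_x (g x * ln (g x))%:E
   - ((\int[mu]_x g x)%R * ln (\int[mu]_x g x)%R)%:E)%E.

Definition energy (G : 'rV[R]_n -> 'rV[R]_n) : \bar R :=
  (\int[mu]_x (dotv (G x) (G x))%:E)%E.

Definition smooth_H1 (f : 'rV[R]_n -> R) : Prop :=
  [/\ smooth f,
      mu.-integrable setT (EFin \o (fun x => f x ^+ 2)) &
      mu.-integrable setT (EFin \o (fun x => dotv (grad f x) (grad f x)))].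

Definition log_sobolev (C : R) : Prop :=
  forall f, smooth_H1 f ->
    (Ent (fun x => f x ^+ 2)%R <= (2 * C)%:E * energy (grad f))%E.

(* +oo when mu satisfies no logarithmic Sobolev inequality. *)
Definition C_LSI : \bar R :=
  ereal_inf [set C%:E | C in [set C : R | 0 <= C /\ log_sobolev C]].

(* u belongs to the Sobolev space W^{1,2}(mu) with gradient G: (u, G) is in the
   L^2(mu)-closure of the pairs (f, grad f), f smooth of finite norm.  No closability
   is assumed: for a general mu (with a singular part, say) G may fail to be
   determined by u.  For u itself smooth one may take G = grad u, see
   smooth_sobolev_gradient. *)
Definition sobolev_gradient (u : 'rV[R]_n -> R) (G : 'rV[R]_n -> 'rV[R]_n) :
    Prop :=
  [/\ measurable_fun setT (u : borel_rV -> R),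
      (forall i, measurable_fun setT ((fun x => G x 0 i) : borel_rV -> R)) &
      exists f : nat -> 'rV[R]_n -> R,
        [/\ (forall k, smooth_H1 (f k)),
            (fun k => (\int[mu]_x ((f k x - u x) ^+ 2)%:E)%E) @ \oo --> 0%E &
            (fun k => energy (fun x => grad (f k) x - G x)) @ \oo --> 0%E]].

Lemma continuous_measurable_rV (f : 'rV[R]_n -> R) :
  continuous f -> measurable_fun setT (f : borel_rV -> R).
Proof.
move=> /continuousP cf.
apply: (measurability _ (measurable_realfun.RGenOpens.measurableE R)).
move=> _ [_ [a [b ->] <-]]; rewrite setTI.
by apply: sub_sigma_algebra; apply: cf; exact: interval_open.
Qed.

Lemma smooth_sobolev_gradient (f : 'rV[R]_n -> R) :
  smooth_H1 f -> sobolev_gradient f (grad f).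
Proof.
move=> fH; have [fs _ _] := fH; split.
- exact: continuous_measurable_rV (fs 0%N).
- move=> i; under eq_fun do rewrite mxE.
  exact: continuous_measurable_rV (((fs 1%N).2 i)).
- exists (fun=> f); split => //.
  + apply: cvg_near_cst; apply: nearW => k.
    by apply: integral0_eq => x _; rewrite subrr expr0n.
  + apply: cvg_near_cst; apply: nearW => k.
    apply: integral0_eq => x _; rewrite subrr /dotv big1// => i _.
    by rewrite mxE mul0r.
Qed.

End Defs.

(* Main.v *)
Require Import Defs.
From HB Require Import structures.
From mathcomp Require Import all_boot all_order all_algebra.
From mathcomp Require Import all_classical all_reals all_analysis.
From mathcomp Require Import measurable_realfun ring lra.
Import Order.TTheory GRing.Theory Num.Theory.
Import numFieldNormedType.Exports.
Local Open Scope classical_set_scope.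
Local Open Scope ring_scope.

Set Implicit Arguments.
Unset Strict Implicit.

(* Write rho = u^2/alpha, a probability density.  By the variational formula for
   the entropy and the log-Sobolev inequality, the quadratic form
   Q(f) = int |grad f|^2 - 1/2 int f^2 log rho is nonnegative; the theorem is
   Cauchy-Schwarz for Q together with Q(u) <= eps int |grad u|^2.

   Since log rho is unbounded, Q is replaced by
     Q_e(f) = int |grad f|^2 + e/2 int f^2 - 1/2 int f^2 log (max(rho, e)),
   0 < e <= 1, which is nonnegative because int max(rho, e) <= 1 + e.  It is first
   bounded for smooth f, then extended to Sobolev pairs by truncating the weight
   from above.  Then Q_e(u) <= eps int |grad u|^2 + O(e), the cross term converges
   at rate sqrt e because |u| |log rho - log (max(rho, e))| <= 2 sqrt(e alpha), and
   Q_e(h) is at most Q(h) + O(e).  When Q(h) = +oo and eps int |grad u|^2 = 0, the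
   bound Q_e(h) = O(1 + log (1/e)) still gives Q_e(u) Q_e(h) -> 0. *)

Section RealInequalities.
Context {R : realType}.
Implicit Types x y g a w d t : R.

Lemma ln_le_subr1 x : 0 < x -> ln x <= x - 1.
Proof.
move=> x0; rewrite -[x in ln x](subrKC 1); apply: le_ln1Dx.
by rewrite ltrBrDr addrC subrr.
Qed.

Lemma xlnx_geN1 x : 0 <= x -> -1 <= x * ln x.
Proof.
rewrite le_eqVlt => /predU1P[<-|x0]; first by rewrite mul0r lerN10.
have := @ln_le_subr1 x^-1; rewrite invr_gt0 lnV ?posrE// => /(_ x0).
rewrite -(ler_pM2l x0) mulrBr divff ?gt_eqF//; nra.
Qed.

Lemma mulr_ln_le g a w : 0 <= g -> 0 < a -> 0 < w ->
  g * ln w <= g * ln g - g * ln a + a * w - g.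
Proof.
rewrite le_eqVlt => /predU1P[<-|g0] a0 w0.
  by rewrite !mul0r !subr0 !add0r mulr_ge0 ?ltW.
have := @ln_le_subr1 (a * w / g); rewrite divr_gt0 ?mulr_gt0// => /(_ isT).
rewrite ln_div ?posrE ?mulr_gt0// lnM ?posrE// -(ler_pM2l g0).
rewrite [g * (_ / g - 1)]mulrBr mulrCA divff ?gt_eqF//; lra.
Qed.

Lemma ler_of_linear_error (K x y : R) : 0 <= K ->
  (forall t, 0 < t -> t <= 1 -> x <= y + K * t) -> x <= y.
Proof.
move=> K0 H; rewrite leNgt; apply/negP => yx.
pose t := Num.min 1 ((x - y) / (2 * (K + 1))).
have K1 : 0 < K + 1 by rewrite ltr_wpDl.
have t0 : 0 < t by rewrite lt_min ltr01 divr_gt0 ?subr_gt0 ?mulr_gt0.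
have := H t t0; rewrite ge_min lexx => /(_ isT); rewrite leNgt => /negP; apply.
have : t <= (x - y) / (2 * (K + 1)) by rewrite ge_min lexx orbT.
rewrite ler_pdivlMr ?mulr_gt0//; nra.
Qed.

Lemma ge0_quadratic_sqr a b c : 0 <= c ->
  (forall t, 0 <= a + 2 * t * b + t ^+ 2 * c) -> b ^+ 2 <= a * c.
Proof.
move=> c0 H; have [c_eq|c_neq] := eqVneq c 0.
  have [->|b0] := eqVneq b 0; first by rewrite expr0n/= c_eq mulr0.
  have := H (- (a + 1) / (2 * b)).
  rewrite c_eq mulr0 addr0.
  have -> : 2 * (- (a + 1) / (2 * b)) * b = - (a + 1).
    by field.
  lra.
have cp : 0 < c by rewrite lt_neqAle eq_sym c_neq.
have := H (- b / c).
have -> : a + 2 * (- b / c) * b + (- b / c) ^+ 2 * c = a - b ^+ 2 / c by field.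
by rewrite subr_ge0 ler_pdivrMr.
Qed.

Lemma ln_truncation_le (u alpha d : R) : 0 < alpha -> 0 < d ->
  `|u| * `|ln (u ^+ 2 / alpha) - ln (Num.max (u ^+ 2 / alpha) d)|
    <= 2 * Num.sqrt (d * alpha).
Proof.
move=> alpha0 d0; set rho := u ^+ 2 / alpha.
have [rd|rd] := leP d rho.
  by rewrite subrr normr0 mulr0 mulr_ge0// sqrtr_ge0.
have [u0|u0] := eqVneq u 0.
  by rewrite u0 normr0 mul0r mulr_ge0// sqrtr_ge0.
have r0 : 0 < rho by rewrite divr_gt0// exprn_even_gt0.
have s0 : 0 < Num.sqrt (d / rho) by rewrite sqrtr_gt0 divr_gt0.
have uE : `|u| = Num.sqrt (alpha * rho).
  by rewrite /rho mulrCA divff ?gt_eqF// mulr1 sqrtr_sqr.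
clearbody rho.
rewrite distrC [`|ln d - _|]ger0_norm; last by rewrite subr_ge0 ler_ln ?posrE// ltW.
rewrite -ln_div ?posrE// -[d / rho]sqr_sqrtr; last by rewrite divr_ge0 ?(ltW d0) ?(ltW r0).
rewrite lnXn// mulr2n.
have := @ln_le_subr1 _ s0.
have -> : Num.sqrt (d * alpha) = `|u| * Num.sqrt (d / rho).
  rewrite uE -sqrtrM; last by rewrite mulr_ge0// ltW.
  by congr (Num.sqrt _); field; rewrite gt_eqF.
move=> /(ler_wpM2l (normr_ge0 u)); have := normr_ge0 u; lra.
Qed.

End RealInequalities.

Section RealIntegrals.
Context {d : measure_display} {T : measurableType d} {R : realType}.
Variable mu : probability T R.
Implicit Types f g W : T -> R.

Local Notation L1 f := (mu.-integrable setT (EFin \o f)).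

Lemma integral_EFin_Rintegral f : L1 f ->
  (\int[mu]_x (f x)%:E)%E = (\int[mu]_x f x)%:E.
Proof. by move=> f1; rewrite /Rintegral fineK//; exact: integrable_fin_num. Qed.

Lemma integrable_le f g : measurable_fun setT f ->
  (forall x, `|f x| <= g x) -> L1 g -> L1 f.
Proof.
move=> mf fg; apply: le_integrable => //; first exact/measurable_EFinP.
by move=> x _ /=; rewrite lee_fin (le_trans (fg x))// ler_norm.
Qed.

Lemma integrableD_EFin f g : L1 f -> L1 g -> L1 (fun x => f x + g x).
Proof. exact: integrableD. Qed.

Lemma integrableZl_EFin (k : R) f : L1 f -> L1 (fun x => k * f x).
Proof. exact: integrableZl. Qed.

Lemma integrable_cst (k : R) : L1 (fun=> k).
Proof. exact: finite_measure_integrable_cst. Qed.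

Lemma Rintegral_probability_cst (k : R) : \int[mu]_x k = k.
Proof.
rewrite /Rintegral integral_cst//.
by rewrite [X in (_ * X)%E](@probability_setT _ _ _ mu) mule1.
Qed.

Lemma measurable_of_integrable f : L1 f -> measurable_fun setT f.
Proof. by move=> /measurable_int /measurable_EFinP. Qed.

Lemma ge0_integrable f : measurable_fun setT f -> (forall x, 0 <= f x) ->
  (\int[mu]_x (f x)%:E < +oo)%E -> L1 f.
Proof.
move=> mf f0 fi; apply/integrableP; split; first exact/measurable_EFinP.
by under eq_integral do rewrite gee0_abs ?lee_fin//.
Qed.

Lemma integrable_lower_bound f g : measurable_fun setT f -> L1 g ->
  (forall x, g x <= f x) -> (\int[mu]_x (f x)%:E < +oo)%E -> L1 f.
Proof.
move=> mf g1 gf fi.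
have mg := measurable_of_integrable g1.
have fg1 : L1 (fun x => f x - g x).
  apply: ge0_integrable.
  - exact: measurable_funB.
  - by move=> x; rewrite subr_ge0.
  have negf : L1 (f^\-).
    apply: (@integrable_le _ (fun x => `|g x|)); last exact: integrable_norm.
      exact: measurable_funrneg.
    move=> x; rewrite /funrneg ger0_norm ?le_max ?lexx ?orbT//.
    rewrite ge_max normr_ge0 andbT lerNl.
    by apply: le_trans (gf x); rewrite lerNl -normrN ler_norm.
  have posf : L1 (f^\+).
    apply: ge0_integrable.
    - exact: measurable_funrpos.
    - by move=> x; rewrite /funrpos le_max lexx orbT.
    move: fi; rewrite integralE funerpos funerneg.
    rewrite (@integral_EFin_Rintegral (funrneg f))//.
    rewrite -[(\int[mu]_x (funrpos f x)%:E)%E]/(\int[mu]_x (EFin \o funrpos f) x)%E.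
    by move: (\int[mu]_x (EFin \o funrpos f) x)%E => [r _||]//; exact: ltry.
  apply: (@integrable_lty _ _ _ mu setT measurableT (EFin \o (fun x => f x - g x))).
  apply: (@integrableB _ _ _ mu setT measurableT (EFin \o f) (EFin \o g)) => //.
  apply: (integrable_le mf _ (integrableD_EFin posf negf)) => x.
  by rewrite -[f^\+ x + f^\- x]/((f^\+ + f^\-) x) funrposDneg.
have -> : f = (fun x => (f x - g x) + g x) by apply/funext => x; rewrite subrK.
exact: integrableD_EFin.
Qed.

Lemma integrable_mul_weight f g W :
  measurable_fun setT f -> measurable_fun setT g -> measurable_fun setT W ->
  (forall x, 0 <= W x) ->
  L1 (fun x => f x ^+ 2 * W x) -> L1 (fun x => g x ^+ 2 * W x) ->
  L1 (fun x => f x * g x * W x).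
Proof.
move=> mf mg mW W0 f1 g1.
apply: (@integrable_le _ (fun x => f x ^+ 2 * W x + g x ^+ 2 * W x)).
- by apply: measurable_funM => //; exact: measurable_funM.
- move=> x; rewrite normrM (ger0_norm (W0 x)) -mulrDl ler_wpM2r//.
  have := sqr_ge0 (f x - g x); have := sqr_ge0 (f x + g x).
  by rewrite ler_norml => fg1 fg2; apply/andP; split; nra.
- exact: integrableD_EFin.
Qed.

(* The variational (Donsker-Varadhan) characterisation of the entropy, tested
   against the truncation from below of a subprobability density. *)
Lemma integral_truncated_ln_le (g rho : T -> R) (e K : R) :
  (forall x, 0 <= g x) -> L1 g -> (forall x, 0 <= rho x) -> L1 rho ->
  \int[mu]_x rho x <= 1 -> 0 < e ->
  (\int[mu]_x (g x * ln (g x))%:E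
    - ((\int[mu]_x g x)%R * ln (\int[mu]_x g x)%R)%:E <= K%:E)%E ->
  (\int[mu]_x (g x * (ln (Num.max (rho x) e) - ln e))%:E
    <= (K + (e - ln e) * \int[mu]_x g x)%:E)%E.
Proof.
move=> g0 g1 rho0 rho1 rho_le1 e0 gK; set A := \int[mu]_x g x.
have mg := measurable_of_integrable g1.
have mrho := measurable_of_integrable rho1.
have A0 : 0 <= A by exact: Rintegral_ge0.
have mlng : measurable_fun setT (fun x => ln (g x)).
  exact: measurableT_comp.
have glng1 : L1 (fun x => g x * ln (g x)).
  apply: (@integrable_lower_bound _ (fun=> -1)).
  - exact: measurable_funM.
  - exact: integrable_cst.
  - by move=> x; exact: xlnx_geN1.
  - by move: gK; case: (\int[mu]_x (g x * ln (g x))%:E)%E => //= r _; exact: ltry.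
move: gK; rewrite integral_EFin_Rintegral// -EFinB lee_fin.
set B := \int[mu]_x (g x * ln (g x)) => BK.
pose W x := ln (Num.max (rho x) e) - ln e.
have w0 x : 0 < Num.max (rho x) e by rewrite lt_max e0 orbT.
have W0 x : 0 <= W x by rewrite subr_ge0 ler_ln ?posrE// le_max lexx orbT.
have mW : measurable_fun setT W.
  apply: measurable_funB => //; apply: measurableT_comp => //.
  exact: measurable_maxr.
have bound a : 0 < a ->
    (\int[mu]_x (g x * W x)%:E
      <= (B - A * ln a + a * (1 + e) - A - A * ln e)%:E)%E.
  move=> a0.
  pose G x := g x * ln (g x) + ((- ln a - 1 - ln e) * g x + (a * rho x + a * e)).
  have i1 : L1 (fun x => a * rho x) by exact: integrableZl_EFin.
  have i2 : L1 (fun=> a * e) by exact: integrable_cst.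
  have i3 : L1 (fun x => a * rho x + a * e) by exact: integrableD_EFin.
  have i4 : L1 (fun x => (- ln a - 1 - ln e) * g x) by exact: integrableZl_EFin.
  have i5 := integrableD_EFin i4 i3.
  have G1 : L1 G by exact: integrableD_EFin.
  apply: (@le_trans _ _ (\int[mu]_x (G x)%:E)%E).
    apply: ge0_le_integral => //.
    - by move=> x _; rewrite lee_fin mulr_ge0.
    - by apply/measurable_EFinP; exact: measurable_funM.
    - exact: measurable_int G1.
    - move=> x _; rewrite lee_fin /G /W.
      have := @mulr_ln_le _ (g x) a _ (g0 x) a0 (w0 x).
      have : Num.max (rho x) e <= rho x + e.
        by rewrite ge_max lerDl ltW//= lerDr.
      by move=> /(ler_wpM2l (ltW a0)); lra.
  rewrite integral_EFin_Rintegral// lee_fin /G RintegralD// RintegralD//.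
  rewrite RintegralD// Rintegral_probability_cst !RintegralZl//.
  rewrite -/A -/B; nra.
have [A_eq0|A_neq0] := eqVneq A 0; last first.
  have Ap : 0 < A by rewrite lt_neqAle eq_sym A_neq0.
  by apply: (le_trans (bound _ Ap)); rewrite lee_fin; move: BK; rewrite -/A; nra.
have fin : L1 (fun x => g x * W x).
  apply: ge0_integrable; first exact: measurable_funM.
    by move=> x; rewrite mulr_ge0.
  by apply: (le_lt_trans (bound _ ltr01)); rewrite ltry.
move: bound; rewrite A_eq0 (integral_EFin_Rintegral fin) => bound.
rewrite lee_fin mulr0 addr0; apply: (@ler_of_linear_error _ (1 + e)); first lra.
move=> t t0 _; have := bound t t0; rewrite lee_fin.
by move: BK; rewrite -/A A_eq0; nra.
Qed.

End RealIntegrals.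

Section SobolevPairs.
Context {R : realType} {n : nat} (mu : probability (borel_rV R n) R).

Local Notation L1 f := (mu.-integrable setT (EFin \o f)).
Local Notation V := (borel_rV R n).

Lemma sqr_le_amgm (s a b : R) : 0 < s ->
  a ^+ 2 <= (1 + s) * b ^+ 2 + (1 + s^-1) * (a - b) ^+ 2.
Proof.
move=> s0; rewrite -subr_ge0.
have -> : (1 + s) * b ^+ 2 + (1 + s^-1) * (a - b) ^+ 2 - a ^+ 2 =
          s^-1 * (s * b - (a - b)) ^+ 2.
  by field; rewrite gt_eqF.
by rewrite mulr_ge0 ?sqr_ge0// invr_ge0 ltW.
Qed.

Lemma dotv_ge0 (v : 'rV[R]_n) : 0 <= dotv v v.
Proof. by apply: sumr_ge0 => i _; rewrite -expr2 sqr_ge0. Qed.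

Lemma dotv_le_amgm (s : R) (v w : 'rV[R]_n) : 0 < s ->
  dotv v v <= (1 + s) * dotv w w + (1 + s^-1) * dotv (v - w) (v - w).
Proof.
move=> s0; rewrite /dotv !mulr_sumr -big_split/=; apply: ler_sum => i _.
by rewrite !mxE -!expr2; exact: sqr_le_amgm.
Qed.

Lemma measurable_dotv (G H : V -> 'rV[R]_n) :
  (forall i, measurable_fun setT ((fun x => G x 0 i) : V -> R)) ->
  (forall i, measurable_fun setT ((fun x => H x 0 i) : V -> R)) ->
  measurable_fun setT ((fun x => dotv (G x) (H x)) : V -> R).
Proof. by move=> mG mH; apply: measurable_sum => i; exact: measurable_funM. Qed.

Lemma measurable_smooth (f : 'rV[R]_n -> R) : smooth f ->
  measurable_fun setT (f : V -> R).
Proof. by move=> fs; exact: continuous_measurable_rV (fs 0%N). Qed.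

Lemma measurable_grad (f : 'rV[R]_n -> R) i : smooth f ->
  measurable_fun setT ((fun x => grad f x 0 i) : V -> R).
Proof.
move=> fs; under eq_fun do rewrite mxE.
exact: continuous_measurable_rV ((fs 1%N).2 i).
Qed.

Lemma Rintegral_le_lincomb (k l : R) (a b c : V -> R) :
  L1 a -> L1 b -> L1 c -> (forall x, a x <= k * b x + l * c x) ->
  \int[mu]_x a x <= k * \int[mu]_x b x + l * \int[mu]_x c x.
Proof.
move=> a1 b1 c1 abc.
rewrite -!RintegralZl// -RintegralD//; try exact: integrableZl_EFin.
apply: le_Rintegral => //.
by apply: integrableD_EFin; exact: integrableZl_EFin.
Qed.

Lemma sobolev_gradient_approx (f : 'rV[R]_n -> R) (G : 'rV[R]_n -> 'rV[R]_n) :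
  sobolev_gradient mu f G ->
  [/\ L1 (fun x => f x ^+ 2), L1 (fun x => dotv (G x) (G x)) &
    forall e, 0 < e -> exists phi : 'rV[R]_n -> R,
     [/\ smooth_H1 mu phi, L1 (fun x => (phi x - f x) ^+ 2),
         L1 (fun x => dotv (grad phi x - G x) (grad phi x - G x)),
         \int[mu]_x (phi x - f x) ^+ 2 <= e &
         \int[mu]_x dotv (grad phi x - G x) (grad phi x - G x) <= e]].
Proof.
case=> mf mG [F [FH Ff FG]].
have approx e : 0 < e -> exists phi : 'rV[R]_n -> R,
     [/\ smooth_H1 mu phi, L1 (fun x => (phi x - f x) ^+ 2),
         L1 (fun x => dotv (grad phi x - G x) (grad phi x - G x)),
         \int[mu]_x (phi x - f x) ^+ 2 <= e &
         \int[mu]_x dotv (grad phi x - G x) (grad phi x - G x) <= e].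
  move=> e0.
  have nbe : nbhs (0%E : \bar R) [set y : \bar R | (y < e%:E)%E].
    apply: open_nbhs_nbhs; split; first exact: open_ereal_lt_ereal.
    by rewrite /= lte_fin.
  have fk_near : \forall k \near \oo,
      (\int[mu]_x ((F k x - f x) ^+ 2)%R%:E < e%:E)%E by exact: Ff nbe.
  have gk_near : \forall k \near \oo,
      (energy mu (fun x => grad (F k) x - G x)%R < e%:E)%E by exact: FG nbe.
  have [k [/= fk gk]] := filter_ex (filterI fk_near gk_near).
  have [sF _ _] := FH k.
  have f1 : L1 (fun x => (F k x - f x) ^+ 2).
    apply: ge0_integrable.
    - apply: measurable_funX; apply: measurable_funB => //.
      exact: measurable_smooth.
    - by move=> x; exact: sqr_ge0.
    - by apply: (lt_le_trans fk); rewrite leey.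
  have g1 : L1 (fun x => dotv (grad (F k) x - G x) (grad (F k) x - G x)).
    apply: ge0_integrable.
    - have mFG i : measurable_fun setT
          ((fun x => (grad (F k) x - G x) 0 i) : V -> R).
        have -> : (fun x => (grad (F k) x - G x) 0 i) =
            (fun x => grad (F k) x 0 i - G x 0 i) by apply/funext => x; rewrite !mxE.
        by apply: measurable_funB => //; exact: measurable_grad.
      exact: measurable_dotv.
    - by move=> x; exact: dotv_ge0.
    - by apply: (lt_le_trans gk); rewrite leey.
  exists (F k); split => //.
  - by rewrite -lee_fin -integral_EFin_Rintegral// ltW.
  - by rewrite -lee_fin -integral_EFin_Rintegral// ltW.
have [phi [[_ p1 gp1] f1 g1 _ _]] := approx 1 ltr01.
split => //.
- apply: (integrable_le _ _ (integrableD_EFin (integrableZl_EFin (1 + 1) p1)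
    (integrableZl_EFin (1 + 1^-1) f1))); first exact: measurable_funX.
  move=> x; rewrite ger0_norm ?sqr_ge0// -[(phi x - _) ^+ 2]sqrrN opprB.
  exact: sqr_le_amgm.
- apply: (integrable_le _ _ (integrableD_EFin (integrableZl_EFin (1 + 1) gp1)
    (integrableZl_EFin (1 + 1^-1) g1))); first exact: measurable_dotv.
  move=> x; rewrite ger0_norm ?dotv_ge0//.
  apply: (le_trans (@dotv_le_amgm 1 _ (grad phi x) ltr01)).
  rewrite lerD2l ler_wpM2l ?addr_ge0 ?invr_ge0//.
  by apply: ler_sum => i _; rewrite !mxE -!expr2 -[leLHS]sqrrN opprB.
Qed.

Lemma integral_min_nat_le (g W : V -> R) (K : \bar R) :
  measurable_fun setT g -> measurable_fun setT W ->
  (forall x, 0 <= g x) -> (forall x, 0 <= W x) ->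
  (forall m : nat, (\int[mu]_x (g x * Num.min (W x) m%:R)%:E <= K)%E) ->
  (\int[mu]_x (g x * W x)%:E <= K)%E.
Proof.
move=> mg mW g0 W0 H.
pose F (m : nat) (x : V) := (g x * Num.min (W x) m%:R)%:E.
have limF x : F m x @[m --> \oo] --> (g x * W x)%:E.
  apply: cvg_near_cst; near=> m; rewrite /F min_l//.
  near: m; exists (Num.bound (W x)) => // m /= bm.
  apply: (le_trans (ltW (archi_boundP (W0 x)))).
  by rewrite ler_nat.
rewrite (eq_integral (fun x => limn (F^~ x))); last first.
  by move=> x _; apply/esym/cvg_lim.
rewrite monotone_convergence//.
- apply: lime_le; last by apply: nearW => m; exact: H.
  apply: ereal_nondecreasing_is_cvgn => a b ab.
  apply: ge0_le_integral => //.
  + by move=> x _; rewrite lee_fin mulr_ge0// le_min W0 ler0n.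
  + apply/measurable_EFinP; apply: measurable_funM => //.
    exact: measurable_minr.
  + apply/measurable_EFinP; apply: measurable_funM => //.
    exact: measurable_minr.
  + move=> x _; rewrite lee_fin ler_wpM2l//.
    by rewrite le_min !ge_min lexx ler_nat ab orbT.
- move=> m; apply/measurable_EFinP; apply: measurable_funM => //.
  exact: measurable_minr.
- by move=> m x _; rewrite lee_fin mulr_ge0// le_min W0 ler0n.
- move=> x _ a b ab; rewrite lee_fin ler_wpM2l//.
  by rewrite le_min !ge_min lexx ler_nat ab orbT.
Unshelve. all: by end_near. Qed.

Lemma sobolev_weighted_le (W : V -> R) (c : R) :
  measurable_fun setT W -> (forall x, 0 <= W x) -> 0 <= c ->
  (forall phi, smooth_H1 mu phi ->
    (\int[mu]_x (phi x ^+ 2 * W x)%:E <=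
     (2 * \int[mu]_x dotv (grad phi x) (grad phi x)
      + c * \int[mu]_x phi x ^+ 2)%:E)%E) ->
  forall f G, sobolev_gradient mu f G ->
    (\int[mu]_x (f x ^+ 2 * W x)%:E <=
     (2 * \int[mu]_x dotv (G x) (G x) + c * \int[mu]_x f x ^+ 2)%:E)%E.
Proof.
move=> mW W0 c0 HW f G fG; have [mf mG _] := fG.
have [f1 G1 approx] := sobolev_gradient_approx fG.
apply: integral_min_nat_le => //; first exact: measurable_funX.
  by move=> x; exact: sqr_ge0.
move=> m; pose Wm x := Num.min (W x) m%:R.
have Wm0 x : 0 <= Wm x by rewrite le_min W0 ler0n.
have mWm : measurable_fun setT Wm by exact: measurable_minr.
have L1W g : L1 (fun x => g x ^+ 2) -> measurable_fun setT (g : V -> R) ->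
    L1 (fun x => g x ^+ 2 * Wm x).
  move=> g1 mg; apply: (integrable_le _ _ (integrableZl_EFin m%:R g1)).
    by apply: measurable_funM => //; exact: measurable_funX.
  move=> x; rewrite ger0_norm; last by rewrite mulr_ge0 ?sqr_ge0.
  rewrite mulrC ler_wpM2r ?sqr_ge0//.
  by rewrite ge_min lexx orbT.
have fW1 := L1W _ f1 mf.
rewrite integral_EFin_Rintegral// lee_fin.
set E := \int[mu]_x dotv (G x) (G x); set A := \int[mu]_x f x ^+ 2.
have E0 : 0 <= E by apply: Rintegral_ge0 => x _; exact: dotv_ge0.
have A0 : 0 <= A by apply: Rintegral_ge0 => x _; exact: sqr_ge0.
pose Y := 2 * E + c * A.
have Y0 : 0 <= Y by rewrite addr_ge0// mulr_ge0.
have m0 : 0 <= (m%:R : R) by exact: ler0n.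
apply: (@ler_of_linear_error _ (3 * Y + 2 * (2 * (2 + c) + m%:R))).
  by rewrite addr_ge0// mulr_ge0// addr_ge0// mulr_ge0// addr_ge0.
move=> t t0 t1; have t20 : 0 < t ^+ 2 by rewrite exprn_gt0.
have [phi [phiH pf1 pG1 pf_le pG_le]] := approx _ t20.
have [phis p1 gp1] := phiH.
have mphi := measurable_smooth phis.
have pW1 := L1W _ p1 mphi.
set r := \int[mu]_x (phi x - f x) ^+ 2 in pf_le.
set q := \int[mu]_x dotv _ _ in pG_le.
have ti0 : 0 <= 1 + t^-1 by rewrite addr_ge0// invr_ge0 ltW.
have le1 : \int[mu]_x (f x ^+ 2 * Wm x) <=
    (1 + t) * \int[mu]_x (phi x ^+ 2 * Wm x) + ((1 + t^-1) * m%:R) * r.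
  apply: Rintegral_le_lincomb => // x.
  apply: (@le_trans _ _ (((1 + t) * phi x ^+ 2
                          + (1 + t^-1) * (f x - phi x) ^+ 2) * Wm x)).
    by rewrite ler_wpM2r//; exact: sqr_le_amgm.
  rewrite mulrDl; apply: lerD; first by rewrite mulrA.
  rewrite -[leLHS]mulrA -[leRHS]mulrA ler_wpM2l//.
  rewrite -[(f x - _) ^+ 2]sqrrN opprB mulrC ler_wpM2r ?sqr_ge0//.
  by rewrite ge_min lexx orbT.
have le2 : \int[mu]_x (phi x ^+ 2 * Wm x) <=
    2 * \int[mu]_x dotv (grad phi x) (grad phi x) + c * \int[mu]_x phi x ^+ 2.
  rewrite -lee_fin -integral_EFin_Rintegral//; apply: le_trans (HW _ phiH).
  apply: ge0_le_integral => //.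
  - by move=> x _; rewrite lee_fin mulr_ge0 ?sqr_ge0.
  - exact: measurable_int pW1.
  - apply/measurable_EFinP; apply: measurable_funM => //.
    exact: measurable_funX.
  - by move=> x _; rewrite lee_fin ler_wpM2l ?sqr_ge0// ge_min lexx.
have le3 : \int[mu]_x dotv (grad phi x) (grad phi x) <=
    (1 + t) * E + (1 + t^-1) * q.
  by apply: Rintegral_le_lincomb => // x; exact: dotv_le_amgm.
have le4 : \int[mu]_x phi x ^+ 2 <= (1 + t) * A + (1 + t^-1) * r.
  by apply: Rintegral_le_lincomb => // x; exact: sqr_le_amgm.
have r0 : 0 <= r by apply: Rintegral_ge0 => x _; exact: sqr_ge0.
have q0 : 0 <= q by apply: Rintegral_ge0 => x _; exact: dotv_ge0.
have ti : (1 + t^-1) * t ^+ 2 <= 2 * t.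
  have -> : (1 + t^-1) * t ^+ 2 = t ^+ 2 + t by field; rewrite gt_eqF.
  by nra.
have rt : (1 + t^-1) * r <= 2 * t.
  by apply: le_trans ti; rewrite ler_wpM2l.
have qt : (1 + t^-1) * q <= 2 * t.
  by apply: le_trans ti; rewrite ler_wpM2l.
have le5 : \int[mu]_x (phi x ^+ 2 * Wm x) <= (1 + t) * Y + 2 * t * (2 + c).
  apply: (le_trans le2).
  have := ler_wpM2l c0 le4; have := ler_wpM2l c0 rt.
  rewrite /Y; move: le3 qt; rewrite !mulrDr; lra.
have mrt := ler_wpM2l m0 rt.
apply: (le_trans le1); rewrite -mulrA (mulrC m%:R) mulrA.
have t1' : 0 <= 1 + t by lra.
have := ler_wpM2l t1' le5.
have : t * (t * Y) <= t * Y by rewrite ler_piMl// mulr_ge0// ltW.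
have : t * (t * (2 + c)) <= t * (2 + c).
  by rewrite ler_piMl// mulr_ge0 ?addr_ge0// ltW.
rewrite -/E -/A -/Y; move: mrt; lra.
Qed.

End SobolevPairs.

Section LogDensityForm.
Context {d : measure_display} {T : measurableType d} {R : realType}.
Variable mu : probability T R.

Local Notation L1 f := (mu.-integrable setT (EFin \o f)).

Lemma measurable_lne_EFin (rho : T -> R) : measurable_fun setT rho ->
  measurable_fun setT (fun x => lne (rho x)%:E).
Proof.
move=> mrho; apply: measurable_fun_ifT => //.
- exact: measurable_fun_ler.
- by apply/measurable_EFinP; exact: measurableT_comp.
Qed.

Lemma integral_le_integrable (f : T -> \bar R) (g : T -> R) :
  measurable_fun setT f -> L1 g -> (forall x, (f x <= (g x)%:E)%E) ->
  (\int[mu]_x f x <= (\int[mu]_x g x)%:E)%E.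
Proof.
move=> mf g1 fg; rewrite -integral_EFin_Rintegral//.
rewrite [leLHS]integralE [leRHS]integralE; apply: leeB.
- apply: ge0_le_integral => //.
  + exact: measurable_funepos.
  + by apply: measurable_funepos; exact: measurable_int g1.
  + by move=> x _; rewrite !funeposE ge_max !le_max fg lexx orbT.
- apply: ge0_le_integral => //.
  + by apply: measurable_funeneg; exact: measurable_int g1.
  + exact: measurable_funeneg.
  + by move=> x _; rewrite !funenegE ge_max !le_max leeN2 fg lexx orbT.
Qed.

Lemma ler_sqrtD_of_sqr (b x K t : R) : 0 <= x -> 0 <= K -> 0 <= t ->
  b ^+ 2 <= x + K * t ^+ 2 -> b <= Num.sqrt x + Num.sqrt K * t.
Proof.
move=> x0 K0 t0 hb; rewrite leNgt; apply/negP => hlt.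
have := sqr_sqrtr x0; have := sqr_sqrtr K0.
have := sqrtr_ge0 x; have := sqrtr_ge0 K.
move: hlt hb; set p := Num.sqrt x; set q := Num.sqrt K => hlt hb q0 p0 hq hp.
have qt0 : 0 <= q * t by rewrite mulr_ge0.
have : (p + q * t) ^+ 2 < b ^+ 2.
  by rewrite ltr_pXn2r ?nnegrE ?addr_ge0// (le_trans _ (ltW hlt))// addr_ge0.
move: hb; rewrite -hp -hq; have := mulr_ge0 p0 qt0; nra.
Qed.

Context (h u : T -> R) (Eh X Eu : R).
Hypothesis mh : measurable_fun setT h.
Hypothesis mu_u : measurable_fun setT u.
Hypothesis h1 : L1 (fun x => h x ^+ 2).
Hypothesis u1 : L1 (fun x => u x ^+ 2).
Let alpha := \int[mu]_x (u x ^+ 2).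
Hypothesis alpha0 : 0 < alpha.
Let rho x := u x ^+ 2 / alpha.
Let L e x := ln (Num.max (rho x) e).

Hypothesis form_ge0 : forall e, 0 < e -> e <= 1 -> forall t,
  (\int[mu]_x ((h x + t * u x) ^+ 2 * (L e x - ln e))%:E <=
    (2 * (Eh + 2 * t * X + t ^+ 2 * Eu)
     + (e - ln e) * \int[mu]_x (h x + t * u x) ^+ 2)%:E)%E.
Hypothesis form_u_ge0 : forall e, 0 < e -> e <= 1 ->
  (\int[mu]_x (u x ^+ 2 * (L e x - ln e))%:E <=
    (2 * Eu + (e - ln e) * alpha)%:E)%E.

Let mrho : measurable_fun setT rho.
Proof. by apply: measurable_funM => //; exact: measurable_funX. Qed.

Let rho0 x : 0 <= rho x.
Proof. by rewrite mulr_ge0 ?sqr_ge0// invr_ge0 ltW. Qed.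

Let mL e : measurable_fun setT (L e).
Proof. by apply: measurableT_comp => //; exact: measurable_maxr. Qed.

Let L_ge e x : 0 < e -> ln e <= L e x.
Proof. by move=> e0; rewrite ler_ln ?posrE// ?lt_max ?e0 ?orbT// le_max lexx orbT. Qed.

Let hu1 : L1 (fun x => h x * u x).
Proof.
apply: (@integrable_le _ _ _ _ _ (fun x => h x ^+ 2 + u x ^+ 2)).
- exact: measurable_funM.
- move=> x; have := sqr_ge0 (h x - u x); have := sqr_ge0 (h x + u x).
  by rewrite ler_norml => ? ?; apply/andP; split; nra.
- exact: integrableD_EFin.
Qed.

Let integrable_weight (f : T -> R) e : L1 f ->
  L1 (fun x => f x * (L e x - ln e)) -> L1 (fun x => f x * L e x).
Proof.
move=> i1 i2; have -> : (fun x => f x * L e x) =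
  (fun x => f x * (L e x - ln e) + ln e * f x).
  by apply/funext => x; ring.
by apply: integrableD_EFin => //; exact: integrableZl_EFin.
Qed.

Let truncated_form e : 0 < e -> e <= 1 ->
  [/\ L1 (fun x => h x ^+ 2 * L e x), L1 (fun x => u x ^+ 2 * L e x),
      L1 (fun x => h x * u x * L e x),
      0 <= Eh + e / 2 * \int[mu]_x h x ^+ 2
           - (\int[mu]_x (h x ^+ 2 * L e x)) / 2 &
      0 <= Eu + e / 2 * alpha - (\int[mu]_x (u x ^+ 2 * L e x)) / 2 /\
      (X + e / 2 * \int[mu]_x (h x * u x)
         - (\int[mu]_x (h x * u x * L e x)) / 2) ^+ 2 <=
      (Eh + e / 2 * \int[mu]_x h x ^+ 2
         - (\int[mu]_x (h x ^+ 2 * L e x)) / 2) *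
      (Eu + e / 2 * alpha - (\int[mu]_x (u x ^+ 2 * L e x)) / 2)].
Proof.
move=> e0 e1.
have W0 x : 0 <= L e x - ln e by rewrite subr_ge0 L_ge.
have mW : measurable_fun setT (fun x => L e x - ln e).
  exact: measurable_funB.
have wint (f : T -> R) (K : R) : measurable_fun setT f ->
    (\int[mu]_x (f x ^+ 2 * (L e x - ln e))%:E <= K%:E)%E ->
    L1 (fun x => f x ^+ 2 * (L e x - ln e)).
  move=> mf fK; apply: ge0_integrable.
  - by apply: measurable_funM => //; exact: measurable_funX.
  - by move=> x; rewrite mulr_ge0 ?sqr_ge0.
  - by apply: le_lt_trans fK _; rewrite ltry.
have uW := wint _ _ mu_u (form_u_ge0 e0 e1).
have hW : L1 (fun x => h x ^+ 2 * (L e x - ln e)).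
  apply: (wint _ (2 * (Eh + 2 * 0 * X + 0 ^+ 2 * Eu)
     + (e - ln e) * \int[mu]_x (h x + 0 * u x) ^+ 2) mh).
  have := form_ge0 e0 e1 0.
  by under eq_integral do rewrite mul0r addr0.
have huW := integrable_mul_weight mh mu_u mW W0 hW uW.
have hL := integrable_weight h1 hW.
have uL := integrable_weight u1 uW.
have huL := integrable_weight hu1 huW.
have u_ge0 : 0 <= Eu + e / 2 * alpha - (\int[mu]_x (u x ^+ 2 * L e x)) / 2.
  have := form_u_ge0 e0 e1; rewrite integral_EFin_Rintegral// lee_fin.
  have -> : \int[mu]_x (u x ^+ 2 * (L e x - ln e)) =
      \int[mu]_x (u x ^+ 2 * L e x) + - ln e * alpha.
    rewrite -RintegralZl// -RintegralD//; last exact: integrableZl_EFin.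
    by apply: eq_Rintegral => x _; ring.
  lra.
have quad t : 0 <= (Eh + e / 2 * \int[mu]_x h x ^+ 2
         - (\int[mu]_x (h x ^+ 2 * L e x)) / 2)
      + 2 * t * (X + e / 2 * \int[mu]_x (h x * u x)
         - (\int[mu]_x (h x * u x * L e x)) / 2)
      + t ^+ 2 * (Eu + e / 2 * alpha - (\int[mu]_x (u x ^+ 2 * L e x)) / 2).
  have expand (w : T -> R) : L1 (fun x => h x ^+ 2 * w x) ->
      L1 (fun x => h x * u x * w x) -> L1 (fun x => u x ^+ 2 * w x) ->
      L1 (fun x => (h x + t * u x) ^+ 2 * w x) /\
      \int[mu]_x ((h x + t * u x) ^+ 2 * w x) =
      \int[mu]_x (h x ^+ 2 * w x) + 2 * t * \int[mu]_x (h x * u x * w x)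
      + t ^+ 2 * \int[mu]_x (u x ^+ 2 * w x).
    move=> w1 w2 w3.
    have -> : (fun x => (h x + t * u x) ^+ 2 * w x) =
       (fun x => (h x ^+ 2 * w x + 2 * t * (h x * u x * w x))
                  + t ^+ 2 * (u x ^+ 2 * w x)).
      by apply/funext => x; ring.
    have i2 := integrableZl_EFin (2 * t) w2.
    have i3 := integrableZl_EFin (t ^+ 2) w3.
    have i12 := integrableD_EFin w1 i2.
    split; first exact: integrableD_EFin.
    by rewrite RintegralD// RintegralD// !RintegralZl.
  have [i1 E1] := expand _ hW huW uW.
  have mul1 (f : T -> R) : L1 f -> L1 (fun x => f x * 1).
    by rewrite (_ : (fun x => f x * 1) = f)//; apply/funext => x; rewrite mulr1.
  have [_ E2] := expand (fun=> 1) (mul1 _ h1) (mul1 _ hu1) (mul1 _ u1).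
  have [_ E3] := expand _ hL huL uL.
  have mulr1E (f : T -> R) : \int[mu]_x (f x * 1) = \int[mu]_x f x.
    by apply: eq_Rintegral => x _; rewrite mulr1.
  rewrite !mulr1E in E2.
  have split_ln (f : T -> R) : L1 f -> L1 (fun x => f x * L e x) ->
     \int[mu]_x (f x * (L e x - ln e)) =
     \int[mu]_x (f x * L e x) + - ln e * \int[mu]_x f x.
    move=> f1 f2; rewrite -RintegralZl// -RintegralD//; last exact: integrableZl_EFin.
    by apply: eq_Rintegral => x _; ring.
  have := form_ge0 e0 e1 t; rewrite integral_EFin_Rintegral// lee_fin.
  rewrite E1 E2 !split_ln// -/alpha; lra.
split => //.
- by have := quad 0; rewrite mulr0 mul0r addr0 expr0n/= mul0r addr0.
- by split => //; exact: ge0_quadratic_sqr u_ge0 quad.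
Qed.

Let lnrho x := ln (rho x).

Let mul_lne x : ((h x * u x)%:E * lne (rho x)%:E)%E = (h x * u x * lnrho x)%:E.
Proof.
have [u0|u0] := eqVneq (u x) 0; first by rewrite u0 mulr0 mul0e mul0r.
by rewrite lne_EFin// divr_gt0// exprn_even_gt0.
Qed.

Let mlnrho : measurable_fun setT lnrho.
Proof. exact: measurableT_comp. Qed.

Let abs_h1 : L1 (fun x => `|h x|).
Proof.
apply: (integrable_le _ _ (integrableD_EFin h1 (integrable_cst mu 1))).
  exact: measurableT_comp.
move=> x; rewrite normr_id ler_norml; have := sqr_ge0 (h x - 1).
by have := sqr_ge0 (h x + 1) => ? ?; apply/andP; split; nra.
Qed.

Let truncation_error e x : 0 < e ->
  `|h x * u x * lnrho x - h x * u x * L e x| <= 2 * Num.sqrt (e * alpha) * `|h x|.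
Proof.
move=> e0; rewrite -mulrBr !normrM -mulrA mulrC ler_wpM2r//.
exact: ln_truncation_le.
Qed.

Let truncation_error_integrable e : 0 < e ->
  L1 (fun x => h x * u x * lnrho x - h x * u x * L e x).
Proof.
move=> e0.
apply: (integrable_le _ _ (integrableZl_EFin (2 * Num.sqrt (e * alpha)) abs_h1)).
  by apply: measurable_funB; apply: measurable_funM => //; exact: measurable_funM.
by move=> x; exact: truncation_error.
Qed.

Let hulnrho1 : L1 (fun x => h x * u x * lnrho x).
Proof.
have [_ _ i1 _ _] := truncated_form ltr01 (lexx 1).
have := integrableD_EFin (truncation_error_integrable ltr01) i1.
by under eq_fun do rewrite subrK.
Qed.

Let truncated_cross_le e : 0 < e -> e <= 1 ->
  \int[mu]_x (h x * u x * L e x) <= \int[mu]_x (h x * u x * lnrho x)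
    + 2 * Num.sqrt (e * alpha) * \int[mu]_x `|h x|.
Proof.
move=> e0 e1; have [_ _ i1 _ _] := truncated_form e0 e1.
rewrite -RintegralZl// -RintegralD//; last exact: integrableZl_EFin.
apply: le_Rintegral => //.
  by apply: integrableD_EFin => //; exact: integrableZl_EFin.
move=> x _; have := truncation_error x e0.
by rewrite ler_norml => /andP[+ _]; lra.
Qed.

Let limit_le (p : R) (K : R) : 0 <= p -> 0 <= K ->
  (forall t, 0 < t -> t <= 1 ->
    (Eh + t ^+ 4 / 2 * \int[mu]_x h x ^+ 2
       - (\int[mu]_x (h x ^+ 2 * L (t ^+ 4) x)) / 2) *
    (Eu + t ^+ 4 / 2 * alpha - (\int[mu]_x (u x ^+ 2 * L (t ^+ 4) x)) / 2)
    <= p + K * t ^+ 2) ->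
  X - (\int[mu]_x (h x * u x * lnrho x)) / 2 <= Num.sqrt p.
Proof.
move=> p0 K0 H.
set M := \int[mu]_x (h x * u x); set N := \int[mu]_x `|h x|.
have N0 : 0 <= N by exact: Rintegral_ge0.
apply: (@ler_of_linear_error _ (Num.sqrt K + `|M| + Num.sqrt alpha * N)).
  by rewrite !addr_ge0 ?mulr_ge0 ?sqrtr_ge0.
move=> t t0 t1; have e0 : 0 < t ^+ 4 by rewrite exprn_gt0.
have e1 : t ^+ 4 <= 1 by rewrite exprn_ile1// ltW.
have [_ _ _ _ [_ B]] := truncated_form e0 e1.
have := ler_sqrtD_of_sqr p0 K0 (ltW t0) (le_trans B (H t t0 t1)).
have := truncated_cross_le e0 e1.
have -> : Num.sqrt (t ^+ 4 * alpha) = t ^+ 2 * Num.sqrt alpha.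
  rewrite sqrtrM ?(ltW e0)// (_ : t ^+ 4 = (t ^+ 2) ^+ 2); last by ring.
  by rewrite sqrtr_sqr ger0_norm// sqr_ge0.
rewrite -/M -/N.
have tt : t ^+ 2 <= t by rewrite expr2 ler_piMl// ltW.
have t4 : t ^+ 4 <= t.
  by rewrite exprS ler_piMr ?(ltW t0)// exprn_ile1// ltW.
have h1' : - (t ^+ 4 * M) <= t * `|M|.
  rewrite -mulrN; apply: (@le_trans _ _ (t ^+ 4 * `|M|)).
    by rewrite ler_wpM2l ?(ltW e0)// -normrN ler_norm.
  by rewrite ler_wpM2r.
have h2' : t ^+ 2 * (Num.sqrt alpha * N) <= t * (Num.sqrt alpha * N).
  by rewrite ler_wpM2r// mulr_ge0// sqrtr_ge0.
have h3' : 0 <= t * `|M| by rewrite mulr_ge0// ltW.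
lra.
Qed.

Lemma log_density_form_le (eps : R) : 0 <= eps -> 0 <= Eu ->
  ((2 * (1 - eps) * Eu)%:E <=
    \int[mu]_x (u x ^+ 2 * ln (u x ^+ 2))%:E - (alpha * ln alpha)%:E)%E ->
  (X%:E - (2^-1)%:E * \int[mu]_x ((h x * u x)%:E * lne (u x ^+ 2 / alpha)%:E)
   <= (Num.sqrt eps)%:E * sqrte Eu%:E
      * sqrte (Eh%:E - (2^-1)%:E *
                \int[mu]_x ((h x ^+ 2)%:E * lne (u x ^+ 2 / alpha)%:E)))%E.
Proof.
move=> eps0 Eu0 hEnt.
rewrite (eq_integral _ _ (fun x _ => mul_lne x)) integral_EFin_Rintegral//.
rewrite -EFinM -EFinB.
set I := (\int[mu]_x ((h x ^+ 2)%:E * _))%E.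
set H := \int[mu]_x h x ^+ 2.
have H0 : 0 <= H by apply: Rintegral_ge0 => x _; exact: sqr_ge0.
have lnu x : u x ^+ 2 * ln (u x ^+ 2) = u x ^+ 2 * lnrho x + ln alpha * u x ^+ 2.
  have [->|u0] := eqVneq (u x) 0; first by rewrite expr0n/= !mul0r mulr0 addr0.
  rewrite /lnrho /rho ln_div ?posrE//; first by ring.
  by rewrite exprn_even_gt0.
have lnrho_le e x : 0 < e -> u x ^+ 2 * lnrho x <= u x ^+ 2 * L e x.
  move=> e0; have [->|u0] := eqVneq (u x) 0; first by rewrite expr0n/= !mul0r.
  rewrite ler_wpM2l ?sqr_ge0// ler_ln ?posrE ?le_max ?lexx//.
    by rewrite divr_gt0// exprn_even_gt0.
  by rewrite lt_max e0 orbT.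
have ulnu1 : L1 (fun x => u x ^+ 2 * ln (u x ^+ 2)).
  have [_ i1 _ _ _] := truncated_form ltr01 (lexx 1).
  have i2 := integrableD_EFin i1 (integrableZl_EFin (ln alpha) u1).
  have mulnu : measurable_fun setT (fun x => u x ^+ 2 * ln (u x ^+ 2)).
    apply: measurable_funM; first exact: measurable_funX.
    by apply: measurableT_comp => //; exact: measurable_funX.
  apply: (integrable_lower_bound mulnu (integrable_cst mu (-1))).
    by move=> x; exact/xlnx_geN1/sqr_ge0.
  apply: le_lt_trans (integral_le_integrable _ i2 _) _.
  - exact/measurable_EFinP.
  - by move=> x; rewrite lee_fin lnu lerD2r lnrho_le.
  - exact: ltry.
have ulnrho1 : L1 (fun x => u x ^+ 2 * lnrho x).
  have := integrableD_EFin ulnu1 (integrableZl_EFin (- ln alpha) u1).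
  by under eq_fun do rewrite lnu mulNr addrK.
move: hEnt; rewrite integral_EFin_Rintegral// -EFinB lee_fin.
under eq_Rintegral do rewrite lnu.
rewrite RintegralD//; last exact: integrableZl_EFin.
rewrite RintegralZl// -/alpha (mulrC alpha) addrK => hEnt.
have Qu_le e : 0 < e -> e <= 1 ->
    Eu + e / 2 * alpha - (\int[mu]_x (u x ^+ 2 * L e x)) / 2
      <= eps * Eu + e / 2 * alpha.
  move=> e0 e1; have [_ i1 _ _ _] := truncated_form e0 e1.
  have : \int[mu]_x (u x ^+ 2 * lnrho x) <= \int[mu]_x (u x ^+ 2 * L e x).
    by apply: le_Rintegral => // x _; exact: lnrho_le.
  lra.
have mI : measurable_fun setT (fun x => ((h x ^+ 2)%:E * lne (rho x)%:E)%E).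
  apply: emeasurable_funM; last exact: measurable_lne_EFin.
  by apply/measurable_EFinP; exact: measurable_funX.
have I_le e : 0 < e -> e <= 1 ->
    (I <= (\int[mu]_x (h x ^+ 2 * L e x))%:E)%E.
  move=> e0 e1; have [i1 _ _ _ _] := truncated_form e0 e1.
  apply: integral_le_integrable => // x; rewrite [leRHS]EFinM.
  apply: lee_wpmul2l; first by rewrite lee_fin sqr_ge0.
  rewrite /lne; case: ifPn => [_|]; first exact: leNye.
  rewrite -ltNge => r0; rewrite lee_fin ler_ln ?posrE ?le_max ?lexx//.
  by rewrite lt_max e0 orbT.
have epsEu_ge0 : 0 <= eps * Eu by rewrite mulr_ge0.
have t4P (t : R) : 0 < t -> t <= 1 -> 0 < t ^+ 4 /\ t ^+ 4 <= 1.
  by move=> t0 t1; rewrite exprn_gt0// exprn_ile1// ltW.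
case: (I) I_le => [i| |] I_le.
- rewrite -[((2^-1)%:E * i%:E)%E]EFinM -EFinB /= -!EFinM lee_fin -sqrtrM// (mulrC 2^-1).
  set q := Eh - 2^-1 * i.
  have Qh_le e : 0 < e -> e <= 1 ->
      Eh + e / 2 * H - (\int[mu]_x (h x ^+ 2 * L e x)) / 2 <= q + e / 2 * H.
    move=> e0 e1; have := I_le e e0 e1; rewrite lee_fin /q; lra.
  have q0 : 0 <= q.
    apply: (@ler_of_linear_error _ H) => // e e0 e1.
    have [_ _ _ hh _] := truncated_form e0 e1.
    have := Qh_le _ e0 e1; have := mulr_ge0 (ltW e0) H0; rewrite -/H in hh; lra.
  rewrite [Num.sqrt (eps * Eu) * _]mulrC -sqrtrM//.
  apply: (@limit_le _ (q * alpha + H * (eps * Eu) + H * alpha)).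
  + by rewrite mulr_ge0.
  + by rewrite !addr_ge0 ?mulr_ge0// ltW.
  move=> t t0 t1; have [e0 e1] := t4P t t0 t1.
  have [_ _ _ hh [uu _]] := truncated_form e0 e1.
  apply: (le_trans (ler_pM hh uu (Qh_le _ e0 e1) (Qu_le _ e0 e1))).
  have te : t ^+ 4 <= t ^+ 2.
    by rewrite (_ : t ^+ 4 = t ^+ 2 * t ^+ 2) ?ler_piMr ?sqr_ge0 ?exprn_ile1 ?(ltW t0)//; ring.
  move: te e0 e1; set e := t ^+ 4 => te e0 e1.
  have a0 := ltW alpha0.
  have k1 : e * (q * alpha) <= t ^+ 2 * (q * alpha) by rewrite ler_wpM2r// mulr_ge0.
  have k2 : e * (H * (eps * Eu)) <= t ^+ 2 * (H * (eps * Eu)).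
    by rewrite ler_wpM2r// !mulr_ge0.
  have k3 : e * (H * alpha) <= t ^+ 2 * (H * alpha) by rewrite ler_wpM2r// mulr_ge0.
  have k4 : e * (e * (H * alpha)) <= e * (H * alpha).
    by rewrite ler_piMl// !mulr_ge0// ltW.
  have k5 : 0 <= e * (q * alpha) by rewrite !mulr_ge0// ltW.
  have k6 : 0 <= e * (H * (eps * Eu)) by rewrite !mulr_ge0// ltW.
  have k7 : 0 <= e * (H * alpha) by rewrite !mulr_ge0// ltW.
  lra.
- by have := I_le 1 ltr01 (lexx 1).
rewrite mulrNy gtr0_sg ?invr_gt0// mul1e /=.
have [epsEu|epsEu] := eqVneq (eps * Eu) 0; last first.
  rewrite -EFinM -sqrtrM// mulry gtr0_sg ?mul1e ?leey//.
  by rewrite sqrtr_gt0 lt_neqAle eq_sym epsEu epsEu_ge0.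
rewrite -EFinM -sqrtrM// epsEu sqrtr0 mul0e lee_fin mulrC -sqrtr0.
have a0 := ltW alpha0.
have K0 : 0 <= alpha / 2 * (`|Eh| + 3 * H).
  by rewrite mulr_ge0 ?divr_ge0// addr_ge0// mulr_ge0.
apply: (limit_le (lexx 0) K0).
move=> t t0 t1; have [e0 e1] := t4P t t0 t1.
have [i1 _ _ hh [uu _]] := truncated_form e0 e1.
have Qh_le : Eh + t ^+ 4 / 2 * H - (\int[mu]_x (h x ^+ 2 * L (t ^+ 4) x)) / 2
    <= (`|Eh| + 3 * H) / t.
  have : ln (t ^+ 4) * H <= \int[mu]_x (h x ^+ 2 * L (t ^+ 4) x).
    rewrite -RintegralZl//; apply: le_Rintegral => //.
      exact: integrableZl_EFin.
    by move=> x _; rewrite mulrC ler_wpM2l ?sqr_ge0// L_ge.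
  rewrite lnXn// -[ln t *+ 4]mulr_natl => lnH.
  have : - ln t <= t^-1 - 1.
    by rewrite -lnV ?posrE//; apply: ln_le_subr1; rewrite invr_gt0.
  move=> /(ler_wpM2r H0) lnt.
  have ti : 1 <= t^-1 by rewrite invf_ge1.
  have hE : `|Eh| <= `|Eh| * t^-1 by rewrite ler_peMr.
  have hH : H <= H * t^-1 by rewrite ler_peMr.
  have hE' := ler_norm Eh.
  have hH' : t ^+ 4 * H <= H by rewrite ler_piMl.
  move: lnH lnt ti hE hH hH'; rewrite -/H.
  move: (ln t) (t^-1) (t ^+ 4) => l s e lnH lnt ti hE hH hH'.
  lra.
have := ler_pM hh uu Qh_le (Qu_le _ e0 e1); rewrite epsEu !add0r => /le_trans; apply.
have -> : (`|Eh| + 3 * H) / t * (t ^+ 4 / 2 * alpha) =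
   t * (alpha / 2 * (`|Eh| + 3 * H) * t ^+ 2) by field; rewrite gt_eqF.
by rewrite ler_piMl// mulr_ge0 ?sqr_ge0.
Qed.

End LogDensityForm.

Section LogSobolev.
Context {R : realType} {n : nat} (mu : probability (borel_rV R n) R).

Local Notation L1 f := (mu.-integrable setT (EFin \o f)).
Local Notation V := (borel_rV R n).

Lemma energy_EFin (G : 'rV[R]_n -> 'rV[R]_n) : L1 (fun x => dotv (G x) (G x)) ->
  energy mu G = (\int[mu]_x dotv (G x) (G x))%:E.
Proof. exact: integral_EFin_Rintegral. Qed.

Lemma Ent_le_of_C_LSI (phi : 'rV[R]_n -> R) : (C_LSI mu <= 1)%E ->
  smooth_H1 mu phi ->
  (Ent mu (fun x => phi x ^+ 2)%R
    <= (2 * \int[mu]_x dotv (grad phi x) (grad phi x))%:E)%E.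
Proof.
move=> LSI phiH; have [_ _ g1] := phiH.
have E0 : 0 <= \int[mu]_x dotv (grad phi x) (grad phi x).
  by apply: Rintegral_ge0 => x _; exact: dotv_ge0.
have bound t : 0 < t -> t <= 1 -> (Ent mu (fun x => phi x ^+ 2)%R <=
    (2 * \int[mu]_x dotv (grad phi x) (grad phi x)
     + 2 * (\int[mu]_x dotv (grad phi x) (grad phi x)) * t)%:E)%E.
  move=> t0 t1.
  have : (C_LSI mu < (1 + t)%:E)%E.
    by apply: (le_lt_trans LSI); rewrite lte_fin ltrDl.
  move=> /ereal_inf_lt[_ [C [C0 CLS] <-]]; rewrite lte_fin => Ct.
  apply: (le_trans (CLS _ phiH)); rewrite energy_EFin// -EFinM lee_fin.
  by have := ler_wpM2r E0 (ltW Ct); lra.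
case: (Ent mu _) bound => [r| |] bound.
- rewrite lee_fin; apply: (@ler_of_linear_error _ (2 * \int[mu]_x dotv (grad phi x) (grad phi x))).
    by rewrite mulr_ge0.
  by move=> t t0 t1; have := bound t t0 t1; rewrite lee_fin.
- by have := bound 1 ltr01 (lexx 1).
- exact: leNye.
Qed.

Lemma partial_lincomb i (t : R) (f g : 'rV[R]_n -> R) :
  (forall x, differentiable f x) -> (forall x, differentiable g x) ->
  partial i (fun x => f x + t * g x) = (fun x => partial i f x + t * partial i g x).
Proof.
move=> df dg; apply/funext => x; rewrite /partial.
have fv : derivable f x (delta_mx 0 i) by exact: diff_derivable.
have gv : derivable g x (delta_mx 0 i) by exact: diff_derivable.
rewrite -[RHS]/(_ + t *: 'D_(delta_mx 0 i) g x) -(deriveZ _ gv) -deriveD//.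
exact: derivableZ.
Qed.

Lemma Ck_lincomb k (t : R) (f g : 'rV[R]_n -> R) :
  Ck k f -> Ck k g -> Ck k (fun x => f x + t * g x).
Proof.
elim: k f g => [|k IH] f g /=.
  by move=> cf cg x; exact: (cvgD (cf x) (cvgM (cvg_cst t) (cg x))).
move=> [df Cf] [dg Cg]; split=> [x|i].
  by apply: (@differentiableD _ _ _ f (t *: g)) => //; exact: differentiableZ.
by rewrite partial_lincomb//; exact: IH.
Qed.

Lemma grad_lincomb (t : R) (f g : 'rV[R]_n -> R) x : smooth f -> smooth g ->
  grad (fun x => f x + t * g x) x = grad f x + t *: grad g x.
Proof.
move=> fs gs; apply/rowP => i; rewrite !mxE partial_lincomb//.
- exact: (fs 1%N).1.
- exact: (gs 1%N).1.
Qed.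

Lemma dotv_lincomb (t : R) (v w : 'rV[R]_n) :
  dotv (v + t *: w) (v + t *: w) =
  dotv v v + (2 * t * dotv v w + t ^+ 2 * dotv w w).
Proof.
rewrite /dotv !mulr_sumr -!big_split/=; apply: eq_bigr => i _.
by rewrite !mxE; ring.
Qed.

Lemma dotvZ (t : R) (v : 'rV[R]_n) : dotv (t *: v) (t *: v) = t ^+ 2 * dotv v v.
Proof.
by rewrite /dotv mulr_sumr; apply: eq_bigr => i _; rewrite !mxE; ring.
Qed.

Lemma norm_dotv_le (v w : 'rV[R]_n) : `|dotv v w| <= dotv v v + dotv w w.
Proof.
rewrite /dotv -big_split/=; apply: (le_trans (ler_norm_sum _ _ _)).
apply: ler_sum => i _; have := sqr_ge0 (v 0 i - w 0 i).
by have := sqr_ge0 (v 0 i + w 0 i) => ? ?; rewrite ler_norml; apply/andP; split; nra.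
Qed.

Lemma integrable_dotv (G H : 'rV[R]_n -> 'rV[R]_n) :
  (forall i, measurable_fun setT ((fun x => G x 0 i) : V -> R)) ->
  (forall i, measurable_fun setT ((fun x => H x 0 i) : V -> R)) ->
  L1 (fun x => dotv (G x) (G x)) -> L1 (fun x => dotv (H x) (H x)) ->
  L1 (fun x => dotv (G x) (H x)).
Proof.
move=> mG mH G1 H1; apply: (integrable_le _ _ (integrableD_EFin G1 H1)).
- exact: measurable_dotv.
- by move=> x; exact: norm_dotv_le.
Qed.

Lemma energy_lincomb (t : R) (G H : 'rV[R]_n -> 'rV[R]_n) :
  (forall i, measurable_fun setT ((fun x => G x 0 i) : V -> R)) ->
  (forall i, measurable_fun setT ((fun x => H x 0 i) : V -> R)) ->
  L1 (fun x => dotv (G x) (G x)) -> L1 (fun x => dotv (H x) (H x)) ->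
  L1 (fun x => dotv (G x + t *: H x) (G x + t *: H x)) /\
  \int[mu]_x dotv (G x + t *: H x) (G x + t *: H x) =
    \int[mu]_x dotv (G x) (G x) + 2 * t * \int[mu]_x dotv (G x) (H x)
    + t ^+ 2 * \int[mu]_x dotv (H x) (H x).
Proof.
move=> mG mH G1 H1; have GH1 := integrable_dotv mG mH G1 H1.
rewrite (_ : (fun x => dotv (G x + _) _) = (fun x => dotv (G x) (G x) +
  (2 * t * dotv (G x) (H x) + t ^+ 2 * dotv (H x) (H x)))); last first.
  by apply/funext => x; exact: dotv_lincomb.
have i2 := integrableZl_EFin (2 * t) GH1.
have i3 := integrableZl_EFin (t ^+ 2) H1.
have i23 := integrableD_EFin i2 i3.
split; first exact: integrableD_EFin.
by rewrite RintegralD// RintegralD// !RintegralZl// addrA.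
Qed.

Lemma smooth_H1_lincomb (t : R) (f g : 'rV[R]_n -> R) :
  smooth_H1 mu f -> smooth_H1 mu g -> smooth_H1 mu (fun x => f x + t * g x).
Proof.
move=> [fs f1 gf1] [gs g1 gg1]; split.
- by move=> k; exact: Ck_lincomb (fs k) (gs k).
- apply: (integrable_le _ _ (integrableD_EFin (integrableZl_EFin 2 f1)
    (integrableZl_EFin (2 * t ^+ 2) g1))).
  + apply: measurable_funX; apply: measurable_funD; first exact: measurable_smooth.
    by apply: measurable_funM => //; exact: measurable_smooth.
  + move=> x; rewrite ger0_norm ?sqr_ge0//.
    by have := sqr_ge0 (f x - t * g x); nra.
- rewrite (_ : (fun x => _) =
    (fun x => dotv (grad f x + t *: grad g x) (grad f x + t *: grad g x))).
    by apply: (energy_lincomb t _ _ gf1 gg1).1 => i; exact: measurable_grad.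
  by apply/funext => x; rewrite grad_lincomb.
Qed.

Lemma sobolev_gradient_lincomb (t : R) (h u : 'rV[R]_n -> R)
    (G : 'rV[R]_n -> 'rV[R]_n) :
  smooth_H1 mu h -> sobolev_gradient mu u G ->
  sobolev_gradient mu (fun x => h x + t * u x) (fun x => grad h x + t *: G x).
Proof.
move=> hH [mu_u mG [F [FH Fu FG]]]; have [hs _ _] := hH.
have t20 : (0 <= (t ^+ 2)%:E :> \bar R)%E by rewrite lee_fin sqr_ge0.
split.
- apply: measurable_funD; first exact: measurable_smooth.
  exact: measurable_funM.
- move=> i; have -> : (fun x => (grad h x + t *: G x) 0 i) =
      (fun x => grad h x 0 i + t * G x 0 i) by apply/funext => x; rewrite !mxE.
  apply: measurable_funD; first exact: measurable_grad.
  exact: measurable_funM.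
- exists (fun k x => h x + t * F k x); split.
  + by move=> k; exact: smooth_H1_lincomb.
  + have -> : (fun k => (\int[mu]_x ((h x + t * F k x - (h x + t * u x)) ^+ 2)%:E)%E)
        = (fun k => ((t ^+ 2)%:E * \int[mu]_x ((F k x - u x) ^+ 2)%:E)%E).
      apply/funext => k; rewrite -ge0_integralZl//.
      * by apply: eq_integral => x _; rewrite -EFinM; congr EFin; ring.
      * apply/measurable_EFinP; apply: measurable_funX; apply: measurable_funB => //.
        by have [Fs _ _] := FH k; exact: measurable_smooth.
      * by move=> x _; rewrite lee_fin sqr_ge0.
    by rewrite -[0%E](mule0 (t ^+ 2)%:E); apply: cvgeZl.
  + have -> : (fun k => energy mu
          (fun x => grad (fun y => h y + t * F k y) x - (grad h x + t *: G x)))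
        = (fun k => ((t ^+ 2)%:E * energy mu (fun x => (grad (F k) x - G x)%R))%E).
      apply/funext => k; have [Fs _ _] := FH k.
      rewrite /energy -ge0_integralZl//.
      * apply: eq_integral => x _; rewrite -EFinM -dotvZ grad_lincomb//.
        by rewrite opprD addrACA subrr add0r scalerBr.
      * apply/measurable_EFinP.
        have mFG i : measurable_fun setT
            ((fun x => (grad (F k) x - G x) 0 i) : V -> R).
          have -> : (fun x => (grad (F k) x - G x) 0 i) =
              (fun x => grad (F k) x 0 i - G x 0 i) by apply/funext => x; rewrite !mxE.
          by apply: measurable_funB => //; exact: measurable_grad.
        exact: measurable_dotv.
      * by move=> x _; rewrite lee_fin dotv_ge0.
    by rewrite -[0%E](mule0 (t ^+ 2)%:E); apply: cvgeZl.
Qed.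

End LogSobolev.

Lemma sobolev_truncated_le {R : realType} {n : nat} (mu : probability (borel_rV R n) R)
    (rho : borel_rV R n -> R) (e : R) (f : 'rV[R]_n -> R)
    (G : 'rV[R]_n -> 'rV[R]_n) :
  (C_LSI mu <= 1)%E -> (forall x, 0 <= rho x) ->
  mu.-integrable setT (EFin \o rho) -> \int[mu]_x rho x <= 1 ->
  0 < e -> e <= 1 -> sobolev_gradient mu f G ->
  (\int[mu]_x (f x ^+ 2 * (ln (Num.max (rho x) e) - ln e))%:E <=
    (2 * \int[mu]_x dotv (G x) (G x) + (e - ln e) * \int[mu]_x f x ^+ 2)%:E)%E.
Proof.
move=> LSI rho0 rho1 rho_le1 e0 e1; apply: sobolev_weighted_le.
- apply: measurable_funB => //; apply: measurableT_comp => //.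
  by apply: measurable_maxr => //; exact: measurable_of_integrable rho1.
- move=> x; rewrite subr_ge0 ler_ln ?posrE ?lt_max ?e0 ?orbT//.
  by rewrite le_max lexx orbT.
- by have := ln_le_subr1 e0; lra.
- move=> phi phiH; have [_ p1 _] := phiH.
  apply: integral_truncated_ln_le => //; first by move=> x; exact: sqr_ge0.
  exact: Ent_le_of_C_LSI.
Qed.

(* When alpha = 0 the density u^2/alpha is the junk value 0. *)
Lemma log_density_form_le_degenerate {d : measure_display} {T : measurableType d}
    {R : realType} (mu : probability T R) (h u : T -> R) (Eh X Eu eps : R) :
  measurable_fun setT h -> measurable_fun setT u ->
  mu.-integrable setT (EFin \o (fun x => u x ^+ 2)) ->
  let alpha := \int[mu]_x u x ^+ 2 in
  alpha = 0 -> 0 <= Eh -> 0 <= Eu -> 0 <= eps -> X ^+ 2 <= Eh * Eu ->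
  ((2 * (1 - eps) * Eu)%:E <=
    \int[mu]_x (u x ^+ 2 * ln (u x ^+ 2))%:E - (alpha * ln alpha)%:E)%E ->
  (X%:E - (2^-1)%:E * \int[mu]_x ((h x * u x)%:E * lne (u x ^+ 2 / alpha)%:E)
   <= (Num.sqrt eps)%:E * sqrte Eu%:E
      * sqrte (Eh%:E - (2^-1)%:E *
                \int[mu]_x ((h x ^+ 2)%:E * lne (u x ^+ 2 / alpha)%:E)))%E.
Proof.
move=> mh mu_u u1 alpha a0 Eh0 Eu0 eps0 XE.
have muu : measurable_fun setT (fun x => u x ^+ 2) by exact: measurable_funX.
have : (\int[mu]_x `|(u x ^+ 2)%:E| = 0)%E.
  under eq_integral do rewrite gee0_abs ?lee_fin ?sqr_ge0//.
  by rewrite integral_EFin_Rintegral// -/alpha a0.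
move=> /ae_eq_integral_abs-/(_ measurableT) u_ae.
have {}u_ae : {ae mu, forall x, u x = 0}.
  have := u_ae ((measurable_EFinP _ _).2 muu).
  apply: filterS => x /(_ I) /= -[ux].
  by apply/eqP; rewrite -sqrf_eq0; apply/eqP.
have mrho (k : R) : measurable_fun setT (fun x => u x ^+ 2 / k).
  by apply: measurable_funM.
rewrite [X in (_ - _ * X <= _)%E](_ : _ = 0%E); last first.
  rewrite (ae_eq_integral (cst 0%E)) ?integral0//.
  - apply: emeasurable_funM; last exact: measurable_lne_EFin.
    by apply/measurable_EFinP; exact: measurable_funM.
  - by apply: filterS u_ae => x ux _; rewrite ux mulr0 mul0e.
rewrite (_ : \int[mu]_x (u x ^+ 2 * ln (u x ^+ 2))%:E = 0)%E; last first.
  rewrite (ae_eq_integral (cst 0%E)) ?integral0//.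
  - apply/measurable_EFinP; apply: measurable_funM => //.
    exact: measurableT_comp.
  - by apply: filterS u_ae => x ux _; rewrite ux expr0n/= mul0r.
rewrite a0 mul0r sube0 mule0 sube0 lee_fin => hEnt.
have I_le0 : (\int[mu]_x ((h x ^+ 2)%:E * lne (u x ^+ 2 / 0)%:E) <= 0)%E.
  have := @integral_le_integrable _ _ _ mu
    (fun x => (h x ^+ 2)%:E * lne (u x ^+ 2 / 0)%:E)%E (fun=> 0).
  rewrite Rintegral_probability_cst; apply.
  - apply: emeasurable_funM; last exact: measurable_lne_EFin.
    by apply/measurable_EFinP; exact: measurable_funX.
  - exact: integrable_cst.
  - move=> x; rewrite invr0 mulr0 /= lexx.
    by rewrite mule_ge0_le0 ?leNye// lee_fin sqr_ge0.
have [Eu_eq0|Eu_neq0] := eqVneq Eu 0.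
  rewrite Eu_eq0 sqrte0 mule0 mul0e lee_fin.
  by move: XE; rewrite Eu_eq0 mulr0 -[X ^+ 2 <= 0]/(_ <= _); nra.
have eps1 : 1 <= eps.
  have : 0 < Eu by rewrite lt_neqAle eq_sym Eu_neq0.
  by move: hEnt; nra.
apply: (@le_trans _ _ ((Num.sqrt eps)%:E * sqrte Eu%:E * sqrte Eh%:E)%E).
  rewrite /= -!EFinM lee_fin -!sqrtrM ?mulr_ge0//.
  apply: (le_trans (ler_norm X)); rewrite -sqrtr_sqr ler_wsqrtr//.
  apply: (le_trans XE); rewrite mulrC ler_wpM2r//.
  by rewrite ler_peMl.
apply: lee_wpmul2l; first by rewrite mule_ge0 ?sqrte_ge0// lee_fin sqrtr_ge0.
have EhQ : (Eh%:E <= Eh%:E - (2^-1)%:E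
    * \int[mu]_x ((h x ^+ 2)%:E * lne (u x ^+ 2 / 0)%:E))%E.
  by rewrite leeDl// oppe_ge0 mule_ge0_le0// lee_fin invr_ge0.
by rewrite lee_sqrt// (le_trans _ EhQ)// lee_fin.
Qed.

Unset Implicit Arguments.

(* lne is the extended logarithm: lne 0 = -oo.  In \bar R, 0 * (-oo) = 0, so that
   h u log(u^2/alpha) vanishes where u = 0, while h^2 log(u^2/alpha) is -oo where
   u = 0 and h <> 0. *)
Theorem lemma3p1 (R : realType) (n : nat) (mu : probability (borel_rV R n) R)
    (mu_LSI : (C_LSI mu <= 1)%E)
    (u : 'rV[R]_n -> R) (gradu : 'rV[R]_n -> 'rV[R]_n)
    (u_H1 : sobolev_gradient mu u gradu)
    (eps : R) (eps_ge0 : 0 <= eps)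
    (u_Ent : ((2 * (1 - eps))%:E * energy mu gradu
              <= Ent mu (fun x => u x ^+ 2)%R)%E)
    (h : 'rV[R]_n -> R) (h_H1 : smooth_H1 mu h) :
  let alpha := (\int[mu]_x (u x ^+ 2))%R in
  (\int[mu]_x (dotv (grad h x) (gradu x))%:E
     - (2^-1)%:E * \int[mu]_x ((h x * u x)%:E * lne ((u x ^+ 2 / alpha)%:E))
   <= (Num.sqrt eps)%:E * sqrte (energy mu gradu)
      * sqrte (energy mu (grad h)
               - (2^-1)%:E
                 * \int[mu]_x ((h x ^+ 2)%:E * lne ((u x ^+ 2 / alpha)%:E))))%E.
Proof.
cbv zeta; set alpha := (\int[mu]_x (u x ^+ 2))%R.
have [mu_u mG _] := u_H1; have [u1 G1 _] := sobolev_gradient_approx u_H1.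
have [hs h1 gh1] := h_H1.
have mh := measurable_smooth hs.
have mgh i := measurable_grad i hs.
rewrite !energy_EFin// integral_EFin_Rintegral; last exact: integrable_dotv.
move: u_Ent; rewrite energy_EFin// -EFinM => u_Ent.
set Eh := \int[mu]_x dotv (grad h x) (grad h x).
set Eu := \int[mu]_x dotv (gradu x) (gradu x) in u_Ent *.
set X := \int[mu]_x dotv (grad h x) (gradu x).
have Eh0 : 0 <= Eh by apply: Rintegral_ge0 => x _; exact: dotv_ge0.
have Eu0 : 0 <= Eu by apply: Rintegral_ge0 => x _; exact: dotv_ge0.
have a_ge0 : 0 <= alpha by apply: Rintegral_ge0 => x _; exact: sqr_ge0.
have E_lin t := energy_lincomb t mgh mG gh1 G1.
have [alpha_eq0|alpha_neq0] := eqVneq alpha 0.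
  apply: log_density_form_le_degenerate => //.
  apply: ge0_quadratic_sqr => // t.
  have := E_lin t => -[_ <-]; apply: Rintegral_ge0 => x _; exact: dotv_ge0.
have alpha0 : 0 < alpha by rewrite lt_neqAle eq_sym alpha_neq0.
have rho0 (x : borel_rV R n) : 0 <= u x ^+ 2 / alpha.
  by rewrite mulr_ge0 ?sqr_ge0// invr_ge0.
have rhoE : (fun x : borel_rV R n => u x ^+ 2 / alpha) =
    (fun x => alpha^-1 * u x ^+ 2) by apply/funext => x; rewrite mulrC.
have rho1 : mu.-integrable setT (EFin \o (fun x => u x ^+ 2 / alpha)).
  by rewrite rhoE; exact: integrableZl_EFin.
have rho_le1 : \int[mu]_x (u x ^+ 2 / alpha) <= 1.
  by rewrite rhoE RintegralZl// mulVf.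
apply: log_density_form_le => //.
- move=> e e0 e1 t.
  have := sobolev_truncated_le mu_LSI rho0 rho1 rho_le1 e0 e1
    (sobolev_gradient_lincomb t h_H1 u_H1).
  by rewrite (E_lin t).2.
- move=> e e0 e1; exact: sobolev_truncated_le.
Qed.
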